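(* Let $\mathbb{F}$ be an algebraically closed field of characteristic zero. For all integers $n,m,d,k\ge1$ and every nonzero linear map $\phi:\mathrm{Ten}(n,d)\to P(m,k)$ (a $W_k$-rank method, with simples $S$ the rank-one tensors in $\mathrm{Ten}(n,d)$), $$\mathrm{Pot}(\phi)\le 2^{k-1}k^d\cdot n^{\lfloor (k-1)d/k\rfloor}.$$
   Context: $\mathrm{Ten}(n,d)=(\mathbb F^n)^{\otimes d}$; rank-one tensors are those of the form $\mathbf v_1\otimes\cdots\otimes\mathbf v_d$. $P(m,k)$ is the space of homogeneous polynomials of degree $k$ in $m$ variables. The Waring rank $\mathrm{wrk}(f)$ of $f\in P(m,k)$ is the least $r$ such that $f=\sum_{i=1}^r\ell_i^k$ with $\ell_i$ linear forms. For a linear $\phi:V\to P(m,k)$ and spanning set $S\subseteq V$, set $\mu_\phi(v)=\mathrm{wrk}(\phi(v))$, $\mu_\phi(X)=\max_{x\in X}\mu_\phi(x)$, and $\mathrm{Pot}(\phi)=\mu_\phi(V)/\mu_\phi(S)$. *)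

(* Defs.v *)
From HB Require Import structures.
From mathcomp Require Import all_boot all_order all_algebra.
Set Implicit Arguments. Unset Strict Implicit. Unset Printing Implicit Defensive.
Import Order.TTheory GRing.Theory Num.Theory.
Local Open Scope ring_scope.

(* Ten(n,d) = (F^n)^{(x) d}, represented in the standard basis:
   a tensor is its array of coordinates indexed by multi-indices (i_1,...,i_d). *)
Notation Ten F n d := {ffun {ffun 'I_d -> 'I_n} -> F^o}.

Definition rank_one (F : fieldType) (n d : nat) (t : Ten F n d) : Prop :=
  exists v : 'I_d -> 'I_n -> F, t = [ffun i : {ffun 'I_d -> 'I_n} => \prod_(j < d) v j (i j)].

Notation mono m k :=
  {a : {ffun 'I_m -> 'I_k.+1} | (\sum_(i < m) (a i : nat))%N == k}.

(* P(m,k): homogeneous polynomials of degree k in m variables, as coefficient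
   vectors indexed by monomials. *)
Notation Pol F m k := {ffun mono m k -> F^o}.

(* ell^k for a linear form ell = sum_i ell_i x_i, expanded by the multinomial
   theorem: coefficient of x^a is (k! / prod_i a_i!) * prod_i ell_i^{a_i}. *)
Definition linpow (F : fieldType) (m k : nat) (l : 'I_m -> F) : Pol F m k :=
  [ffun a : mono m k =>
     ((k`! %/ \prod_(i < m) (val a i : nat)`!)%N)%:R * \prod_(i < m) l i ^+ (val a i : nat)].

Definition wrk_le (F : fieldType) (m k : nat) (f : Pol F m k) (r : nat) : Prop :=
  exists l : 'I_r -> 'I_m -> F, f = \sum_(i < r) linpow k (l i).

(* Main.v *)
Require Import Defs.
From HB Require Import structures.
From mathcomp Require Import all_boot all_order all_algebra.
From mathcomp Require Import generic_quotient boolp classical_sets functions filter.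
Set Implicit Arguments. Unset Strict Implicit. Unset Printing Implicit Defensive.
From mathcomp Require Import ring zify.
Import Order.TTheory GRing.Theory Num.Theory.
Local Open Scope ring_scope.

(* Over an extension K of F, obtained by iterated ultrapowers, there are a point
   x = (x_1, ..., x_d) of (K^n)^d and derivations D_(j,i) of K over F with
   D_(j,i) x_(j',i') = delta. Each ultrapower adds one coordinate, the class of
   the sequence of natural numbers, and derivations extend to it because the
   characteristic is zero. The hypothesis passes to ultrapowers, so
   phi(x_1 (x) ... (x) x_d) = \sum_(i < r) l_i^k with linear forms l_i over K.
   Applying D_(1,i_1) ... D_(d,i_d) turns the left-hand side into
   phi(e_(i_1) (x) ... (x) e_(i_d)), and by the Leibniz rule the right-hand side
   into a sum over i < r and over the maps A : [d] -> [k] of products of k linear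
   forms, the c-th of which depends only on the indices i_j with A(j) = c. When
   these are summed against the coordinates of a tensor v, the form attached to a
   largest fibre of A absorbs the indices of that fibre, which leaves at most
   n^((k-1)d/k) products of k linear forms for each i and A; by polarization each
   of them is a sum of 2^(k-1) k-th powers. Hence the bound holds over K, and it
   descends to F since a system of polynomial equations over F that is solvable in
   an ultrapower of F is solvable in F. *)

(** * Ultrapowers *)

Section Ultrapower.
Local Open Scope classical_set_scope.
Local Open Scope quotient_scope.
Variables (E : fieldType) (U : set_system nat).
Hypothesis UF : UltraFilter U.

Definition ultranull (f : nat -> E) : bool := `[< U [set s | f s = 0] >].

Fact ultranull_idealr : @idealr_closed (nat -> E : comNzRingType) ultranull.
Proof.
split; rewrite ?unfold_in.
- by apply/asboolP; apply: filterS filterT => s _.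
- apply/negP => /asboolP /filter_ex[s /= /eqP].
  by rewrite (_ : (1 : nat -> E) s = 1) // oner_eq0.
move=> a u v /asboolP Uu /asboolP Uv; apply/asboolP.
apply: filterS2 Uu Uv => s /= us vs.
by rewrite [LHS](_ : _ = a s * u s + v s) // us vs mulr0 addr0.
Qed.

HB.instance Definition _ :=
  isIdealr.Build (nat -> E : comNzRingType) ultranull ultranull_idealr.

Definition ultraideal : idealr (nat -> E : comNzRingType) := ultranull.

Definition ultrapower := {ideal_quot ultraideal}.
HB.instance Definition _ := GRing.ComNzRing.on ultrapower.

Definition ultraclass (f : nat -> E) : ultrapower := \pi f.

Lemma ultraclass_eq0 f : ultraclass f = 0 <-> U [set s | f s = 0].
Proof.
rewrite /ultraclass; split=> [/eqP|Uf].
  by rewrite -(rmorph0 \pi_ultrapower) -Quotient.idealrBE subr0 => /asboolP.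
apply/eqP; rewrite -(rmorph0 \pi_ultrapower) -Quotient.idealrBE subr0.
exact/asboolP.
Qed.

Definition ultrainv (q : ultrapower) : ultrapower :=
  ultraclass (fun s => (repr q s)^-1).

Fact ultra_mulVf q : q != 0 -> ultrainv q * q = 1.
Proof.
move=> q0; rewrite -[in X in _ * X](reprK q) /ultrainv /ultraclass -rmorphM.
apply/eqP; rewrite -subr_eq0 -(rmorph1 \pi_ultrapower) -rmorphB; apply/eqP.
apply/ultraclass_eq0.
(* Either the zero set of the representative is in [U] and [q] is zero, or its complement is, and
   there the pointwise inverse works. *)
case: (in_ultra_setVsetC [set s | repr q s = 0] UF) => [U0|].
  by case/eqP: q0; rewrite -(reprK q); apply/ultraclass_eq0.
apply: filterS => s /= /eqP qs.
by rewrite [LHS](_ : _ = (repr q s)^-1 * repr q s - 1) // mulVf // subrr.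
Qed.

Fact ultra_invr0 : ultrainv 0 = 0.
Proof.
apply/ultraclass_eq0; have /ultraclass_eq0 : ultraclass (repr (0 : ultrapower)) = 0.
  exact: reprK.
by apply: filterS => s /= ->; rewrite invr0.
Qed.

HB.instance Definition _ :=
  GRing.ComNzRing_isField.Build ultrapower ultra_mulVf ultra_invr0.

HB.instance Definition _ :=
  GRing.RMorphism.copy ultraclass (\pi_ultrapower : {rmorphism (nat -> E) -> _}).

Lemma ultraclass_surj (q : ultrapower) : exists f, ultraclass f = q.
Proof. by exists (repr q); rewrite /ultraclass reprK. Qed.

End Ultrapower.

(** This form of characteristic zero passes along field morphisms by injectivity. *)
Definition char0 (E : fieldType) := forall s : nat, s.+1%:R != 0 :> E.

Lemma char0_natr_inj (E : fieldType) :
  char0 E -> injective (fun s : nat => s%:R : E).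
Proof.
move=> cE; suff H a b : (a <= b)%N -> a%:R = b%:R :> E -> a = b.
  by move=> a b; case/orP: (leq_total a b) => /H// + /esym; move=> /[apply].
move=> ab /eqP; rewrite eq_sym -subr_eq0 -natrB //.
case e: (b - a)%N => [|c]; last by rewrite (negPf (cE c)).
by move=> _; apply/eqP; rewrite eqn_leq ab -subn_eq0 e.
Qed.

Lemma char0_poly_eq0 (E : fieldType) (p : {poly E}) :
  char0 E -> (forall N, exists2 s, (N <= s)%N & root p s%:R) -> p = 0.
Proof.
move=> cE H; apply/eqP/negPn/negP => p0.
have [rs [szrs urs rrs]] : exists rs : seq nat,
    [/\ size rs = size p, uniq rs & all (fun s => root p s%:R) rs].
  elim: (size p) => [|k [rs [<- urs rrs]]]; first by exists [::].
  (* The new root exceeds all earlier ones, which keeps the list duplicate-free. *)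
  have [s s_gt rs_s] := H (\max_(i <- rs) i).+1.
  exists (s :: rs); split=> //=; last by rewrite rs_s.
  rewrite urs andbT; apply/negP => sin.
  by move: s_gt; rewrite ltnNge; case/negP; apply: leq_bigmax_seq.
have : (size [seq s%:R : E | s <- rs] < size p)%N.
  apply: max_poly_roots => //.
    by apply/allP => _ /mapP[s /(allP rrs) + ->].
  by rewrite map_inj_uniq //; apply: char0_natr_inj.
by rewrite size_map szrs ltnn.
Qed.

Section ConstantSequence.
Variable E : fieldType.

(** The diagonal embedding, named so that it can carry the ring morphism structure. *)
Definition const_seq (c : E) : nat -> E := fun=> c.

Fact const_seq_is_zmod_morphism : zmod_morphism const_seq.
Proof. by []. Qed.

Fact const_seq_is_monoid_morphism : monoid_morphism const_seq.
Proof. by []. Qed.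

HB.instance Definition _ :=
  GRing.isZmodMorphism.Build _ _ const_seq const_seq_is_zmod_morphism.
HB.instance Definition _ :=
  GRing.isMonoidMorphism.Build _ _ const_seq const_seq_is_monoid_morphism.

End ConstantSequence.

(* [E'] is an ultrapower of [E] along a free ultrafilter on [nat], and [x] the
   class of the sequence of natural numbers. *)
Lemma generic_extension (E : fieldType) : char0 E ->
  exists (E' : fieldType) (pi : {rmorphism (nat -> E) -> E'}) (x : E'),
  [/\ forall q, exists f, pi f = q,
      forall (T : finType) (f : T -> nat -> E),
        (forall t, pi (f t) = 0) -> exists s, forall t, f t s = 0 &
      forall p : {poly E}, p != 0 ->
        (map_poly (pi \o @const_seq E) p).[x] != 0].
Proof.
move=> cE; have [U [UF oU]] := ultraFilterLemma eventually_filter.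
exists (ultrapower E UF : fieldType).
exists (ultraclass UF : {rmorphism _ -> _}).
exists (ultraclass UF (fun s => s%:R)); split.
- exact: ultraclass_surj.
- move=> T f H.
  (* Finitely many members of [U] have a common point. *)
  have /filter_forall/filter_ex[s Hs] t : U [set s | f t s = 0]%classic.
    by have /ultraclass_eq0 := H t.
  by exists s.
move=> p; apply: contra_neq.
have -> : (map_poly (ultraclass UF \o @const_seq E) p).[ultraclass UF (fun s => s%:R)]
    = ultraclass UF (fun s => p.[s%:R]).
  elim/poly_ind: p => [|p c IH].
    rewrite rmorph0 horner0; apply/esym/ultraclass_eq0.
    by apply: filterS filterT => s _ /=; rewrite horner0.
  rewrite rmorphD rmorphM /= map_polyX map_polyC hornerMXaddC IH /=.
  rewrite -rmorphM -rmorphD; congr (ultraclass UF _).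
  by apply/funext => s; rewrite hornerMXaddC.
(* [U] contains every tail of [nat], so its members are unbounded and [p] has arbitrarily large
   natural roots. *)
move=> /ultraclass_eq0 U0; apply: char0_poly_eq0 => // N.
have UN : U [set s | (N <= s)%N]%classic by apply: oU; exists N.
have [s [/= p0 sN]] := filter_ex (filterI U0 UN).
by exists s => //; apply/eqP.
Qed.

(** * Derivations *)

Definition derivation (K : fieldType) (D : K -> K) : Prop :=
  (forall a b, D (a + b) = D a + D b) /\
  (forall a b, D (a * b) = D a * b + a * D b).

Section DerivationTheory.
Variables (K : fieldType) (D : K -> K) (hD : derivation D).

Lemma derD a b : D (a + b) = D a + D b. Proof. by case: hD. Qed.
Lemma derM a b : D (a * b) = D a * b + a * D b. Proof. by case: hD. Qed.

Lemma der0 : D 0 = 0.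
Proof. by apply: (addrI (D 0)); rewrite -derD !addr0. Qed.

Lemma der1 : D 1 = 0.
Proof. by apply: (addrI (D 1)); rewrite addr0 -{3}[1]mulr1 derM mulr1 mul1r. Qed.

Lemma der_sum I (r : seq I) (P : pred I) f :
  D (\sum_(i <- r | P i) f i) = \sum_(i <- r | P i) D (f i).
Proof. exact: (big_morph D derD der0). Qed.

Lemma der_nat s : D s%:R = 0.
Proof. by elim: s => [|s IH]; rewrite ?der0 // mulrS derD der1 IH addr0. Qed.

Lemma derMc a c : D c = 0 -> D (a * c) = D a * c.
Proof. by move=> Dc; rewrite derM Dc mulr0 addr0. Qed.

Lemma der_prod_const I (r : seq I) (P : pred I) f :
  (forall i, P i -> D (f i) = 0) -> D (\prod_(i <- r | P i) f i) = 0.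
Proof.
move=> H; apply: (big_ind (fun z => D z = 0)); rewrite ?der1 // => a b Da Db.
by rewrite derM Da Db mul0r mulr0 addr0.
Qed.

Lemma der_prod k (f : 'I_k -> K) :
  D (\prod_c f c) = \sum_c \prod_c' (if c == c' then D (f c') else f c').
Proof.
elim: k f => [|k IH] f; first by rewrite !big_ord0 der1.
rewrite big_ord_recl derM IH [RHS]big_ord_recl big_ord_recl eqxx.
congr (_ * _ + _); rewrite mulr_sumr; apply: eq_bigr => c _.
by rewrite big_ord_recl.
Qed.

End DerivationTheory.

(** * Extension of derivations from a subring to the whole field *)

Section DerivationExtension.
Local Open Scope classical_set_scope.
Variable K : fieldType.
Hypothesis charK0 : char0 K.

(* Derivations from a subring of [K] to [K] are encoded by their graphs, that is
   by the subrings of the dual numbers over [K] that project injectively. *)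
Record der_graph (G : set (K * K)) : Prop := DerGraph {
  dg_one : G (1, 0);
  dg_sub : forall a b, G a -> G b -> G (a.1 - b.1, a.2 - b.2);
  dg_mul : forall a b, G a -> G b -> G (a.1 * b.1, a.2 * b.1 + a.1 * b.2);
  dg_fun : forall b, G (0, b) -> b = 0 }.

Section Basics.
Variables (G : set (K * K)) (hG : der_graph G).

Lemma dg_zero : G (0, 0).
Proof. by have := dg_sub hG (dg_one hG) (dg_one hG); rewrite /= !subrr. Qed.

Lemma dg_opp a : G a -> G (- a.1, - a.2).
Proof. by move=> Ga; have := dg_sub hG dg_zero Ga; rewrite /= !sub0r. Qed.

Lemma dg_add a b : G a -> G b -> G (a.1 + b.1, a.2 + b.2).
Proof. by move=> Ga /dg_opp Gb; have := dg_sub hG Ga Gb; rewrite /= !opprK. Qed.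

Lemma dg_sum n (a b : nat -> K) : (forall i, (i < n)%N -> G (a i, b i)) ->
  G (\sum_(i < n) a i, \sum_(i < n) b i).
Proof.
elim: n => [|n IH] H; first by rewrite !big_ord0; apply: dg_zero.
rewrite !big_ord_recr /=; apply: (dg_add (IH _) (H n _)) => // i ltin.
exact/H/ltnW.
Qed.

Lemma dg_inj a b c : G (a, b) -> G (a, c) -> b = c.
Proof.
move=> Gb Gc; have := dg_sub hG Gb Gc; rewrite /= subrr.
by move/(dg_fun hG) => /eqP; rewrite subr_eq0 => /eqP.
Qed.

(* [P + eps Q] is a polynomial over the subring of dual numbers given by [G],
   and [dual_eval] the [eps] part of its value at [z + eps w]. *)
Definition dg_poly (P Q : {poly K}) := forall i, G (P`_i, Q`_i).
Definition dual_eval (z w : K) (P Q : {poly K}) := P^`().[z] * w + Q.[z].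

Lemma dg_polyC a b : G (a, b) -> dg_poly a%:P b%:P.
Proof.
by move=> Gab i; rewrite !coefC; case: (i == 0)%N => //; apply: dg_zero.
Qed.

Lemma dg_polyX : dg_poly 'X 0.
Proof.
by move=> i; rewrite coefX coef0; case: (i == 1)%N; [apply: dg_one | apply: dg_zero].
Qed.

Lemma dg_polyB P Q R S : dg_poly P Q -> dg_poly R S -> dg_poly (P - R) (Q - S).
Proof. by move=> h1 h2 i; rewrite !coefB; apply: (dg_sub hG (h1 i) (h2 i)). Qed.

Lemma dg_polyM P Q R S :
  dg_poly P Q -> dg_poly R S -> dg_poly (P * R) (Q * R + P * S).
Proof.
move=> h1 h2 i; rewrite coefD !coefM -big_split /=.
pose a j := P`_j * R`_(i - j); pose b j := Q`_j * R`_(i - j) + P`_j * S`_(i - j).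
apply: (@dg_sum _ a b) => j _; exact: (dg_mul hG (h1 j) (h2 _)).
Qed.

Lemma dual_evalB z w P Q R S :
  dual_eval z w (P - R) (Q - S) = dual_eval z w P Q - dual_eval z w R S.
Proof. by rewrite /dual_eval derivB !(hornerD, hornerN); ring. Qed.

Lemma dual_evalM z w P Q R S :
  dual_eval z w (P * R) (Q * R + P * S) =
  dual_eval z w P Q * R.[z] + P.[z] * dual_eval z w R S.
Proof. by rewrite /dual_eval derivM !(hornerD, hornerM); ring. Qed.

(** The subring of the dual numbers generated by [G] and [z + eps w], as the image of evaluation. *)
Definition dg_adjoin (z w : K) : set (K * K) :=
  [set e | exists P Q, dg_poly P Q /\ e = (P.[z], dual_eval z w P Q)].

Lemma dg_adjoin_graph z w :
    (forall P Q, dg_poly P Q -> root P z -> dual_eval z w P Q = 0) ->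
  der_graph (dg_adjoin z w).
Proof.
move=> H; split.
- exists 1, 0; split; first exact: (dg_polyC (dg_one hG)).
  by rewrite /dual_eval derivC !hornerE.
- move=> _ _ [P [Q [h1 ->]]] [R [S [h2 ->]]]; exists (P - R), (Q - S).
  by split; [apply: dg_polyB | rewrite dual_evalB !hornerE].
- move=> _ _ [P [Q [h1 ->]]] [R [S [h2 ->]]]; exists (P * R), (Q * R + P * S).
  by split; [apply: dg_polyM | rewrite dual_evalM !hornerE].
- by move=> b [P [Q [h [/esym/eqP P0 ->]]]]; apply: H.
Qed.

Lemma dg_adjoin_sub z w : G `<=` dg_adjoin z w.
Proof.
move=> [a b] Gab; exists a%:P, b%:P; split; first exact: dg_polyC.
by rewrite /dual_eval derivC !hornerE.
Qed.

Lemma dg_adjoin_mem z w : dg_adjoin z w (z, w).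
Proof.
exists 'X, 0; split; first exact: dg_polyX.
by rewrite /dual_eval derivX !hornerE.
Qed.

(* If [z] is algebraic over the domain of [G], take [P0] of minimal size among
   the nonzero polynomials that vanish at [z]; then [P0^`().[z]] is nonzero and
   [w] is determined. Every other [P] reduces to it by pseudo-division. *)
Lemma dg_adjoin_exists z :
  exists w, forall P Q, dg_poly P Q -> root P z -> dual_eval z w P Q = 0.
Proof.
(* If no nonzero polynomial over the domain of [G] vanishes at [z], every [w] is admissible and zero
   is chosen. *)
case: (pselect (exists P Q, [/\ dg_poly P Q, root P z & P != 0])); last first.
  move=> none; exists 0 => P Q h Pz; have [P0|P0] := eqVneq P 0; last first.
    by case: none; exists P, Q.
  suff -> : Q = 0 by rewrite /dual_eval P0 deriv0 !hornerE.
  apply/polyP => i; rewrite coef0; apply: (dg_fun hG).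
  by have := h i; rewrite P0 coef0.
move=> ex; pose good s := `[< exists P Q,
  [/\ dg_poly P Q, root P z, P != 0 & size P = s] >].
have exg : exists s, good s.
  by case: ex => P [Q [h Pz P0]]; exists (size P); apply/asboolP; exists P, Q.
case: (ex_minnP exg) => s /asboolP[P0 [Q0 [h0 P0z P0n sP0]]] smin.
have dP0 : P0^`().[z] != 0.
  apply/negP => P0'z; have [Q0' hQ0'] : exists Q, dg_poly P0^`() Q.
    exists Q0^`() => i; rewrite !coef_deriv.
    move: (P0`_i.+1) (Q0`_i.+1) (h0 i.+1) => a b Gab.
    elim: (i.+1) => [|m IH]; first by rewrite !mulr0n; apply: dg_zero.
    by rewrite !mulrS; apply: (dg_add Gab IH).
  have P0'n : P0^`() != 0.
    apply/eqP => /polyP/(_ (size P0).-2); rewrite coef0 coef_deriv.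
    have sz2 : (1 < size P0)%N by apply: root_size_gt1 P0z.
    rewrite prednK ?ltn_predRL // -lead_coefE -mulr_natr => /eqP.
    rewrite mulf_eq0 lead_coef_eq0 (negPf P0n) /=.
    by case: (size P0) sz2 => [|[|m]] //= _; rewrite (negPf (charK0 _)).
  have /smin : good (size P0^`()) by apply/asboolP; exists P0^`(), Q0'.
  by rewrite -sP0 leqNgt lt_size_deriv.
have [w ev0] : exists w, dual_eval z w P0 Q0 = 0.
  by exists (- Q0.[z] / P0^`().[z]); rewrite /dual_eval; field.
exists w => P; have [m] := ubnP (size P); elim: m P => // m IH P szP Q h Pz.
have [Pe|Pn] := eqVneq P 0.
  suff -> : Q = 0 by rewrite /dual_eval Pe deriv0 !hornerE.
  apply/polyP => i; rewrite coef0; apply: (dg_fun hG).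
  by have := h i; rewrite Pe coef0.
have le_sz : (size P0 <= size P)%N.
  by rewrite sP0; apply: smin; apply/asboolP; exists P, Q.
pose k := (size P - size P0)%N.
have hC := dg_polyC (h0 (size P0).-1); have hL := dg_polyC (h (size P).-1).
have hXk : exists S, dg_poly 'X^k S.
  elim: (k) => [|j [S hS]].
    by exists 0; rewrite expr0; apply: (dg_polyC (dg_one hG)).
  by rewrite exprS; eexists; apply: (dg_polyM dg_polyX hS).
case: hXk => S hS.
(* One step of pseudo-division: the combination cancels the leading term of [P], and its dual value
   is that of [P] times the leading coefficient of [P0]. *)
have h1 := dg_polyM hC h; have h2 := dg_polyM (dg_polyM hL hS) h0.
have h3 := dg_polyB h1 h2.
have P1z : root ((P0`_(size P0).-1)%:P * P - (P`_(size P).-1)%:P * 'X^k * P0) z.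
  by rewrite rootE !hornerE (eqP Pz) (eqP P0z) !mulr0 subrr.
have {}IH := IH _ _ _ h3 P1z.
have /IH : (size ((P0`_(size P0).-1)%:P * P - (P`_(size P).-1)%:P * 'X^k * P0)%R < m)%N.
  have P_gt0 : (0 < size P)%N by rewrite lt0n size_poly_eq0.
  have P0_gt0 : (0 < size P0)%N by rewrite lt0n size_poly_eq0.
  apply: leq_trans (_ : size P <= m)%N; last by rewrite -ltnS.
  rewrite -[X in (_ < X)%N](prednK P_gt0) ltnS; apply/leq_sizeP => j.
  rewrite coefB -mulrA !coefCM coefXnM leq_eqVlt => /predU1P[<-|ltj].
    rewrite ltnNge /k (_ : _ - _ <= _)%N; last by lia.
    have -> : ((size P).-1 - (size P - size P0) = (size P0).-1)%N by lia.
    by rewrite mulrC subrr.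
  rewrite ltnNge (_ : k <= j)%N /k; last by lia.
  have sPj : (size P <= j)%N by lia.
  have sP0j : (size P0 <= j - (size P - size P0))%N by lia.
  rewrite (nth_default _ sPj) (nth_default _ sP0j).
  by rewrite !mulr0 subrr.
rewrite dual_evalB !dual_evalM ev0 (eqP Pz) (eqP P0z) !mulr0 !add0r subr0.
rewrite hornerC => /eqP; rewrite mulf_eq0 -lead_coefE lead_coef_eq0 (negPf P0n).
by move/eqP.
Qed.

End Basics.

Lemma der_graph_extend (G : set (K * K)) : der_graph G ->
  exists D, derivation D /\ forall e, G e -> D e.1 = e.2.
Proof.
move=> hG.
(* The maximal object is sought among the sets whose union with [G] is a graph, so that the empty
   chain also has an admissible union. *)
have [|A [hA Amax]] := @Zorn_bigcup _ (fun A => der_graph (G `|` A)).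
  move=> C CP Ctot.
  (* The closure conditions involve two elements at a time, and any two lie in one graph coming from
     the chain. *)
  have pair a b : (G `|` \bigcup_(X in C) X) a -> (G `|` \bigcup_(X in C) X) b ->
      exists H, [/\ der_graph H, H a, H b & H `<=` G `|` \bigcup_(X in C) X].
    have sub X : C X -> G `|` X `<=` G `|` \bigcup_(X in C) X.
      by move=> CX; apply: setUS; apply: bigcup_sup.
    case=> [Ga|[X CX Xa]] [Gb|[Y CY Yb]].
    - by exists G; split=> // e; left.
    - by exists (G `|` Y); split; [exact: CP|left|right|exact: sub].
    - by exists (G `|` X); split; [exact: CP|right|left|exact: sub].
    - case: (Ctot X Y CX CY) => XY.
        by exists (G `|` Y); split; [exact: CP|right; exact: XY|right|exact: sub].
      by exists (G `|` X); split; [exact: CP|right|right; exact: XY|exact: sub].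
  split; first by left; apply: dg_one.
  - by move=> a b /pair/[apply] -[H [hH Ha Hb]]; apply; apply: dg_sub.
  - by move=> a b /pair/[apply] -[H [hH Ha Hb]]; apply; apply: dg_mul.
  - move=> b bG; have [H [hH Ha _ _]] := pair _ _ bG bG; exact: (dg_fun hH).
have tot z : exists w, (G `|` A) (z, w).
  have [w Hw] := dg_adjoin_exists hA z; exists w.
  have hB := dg_adjoin_graph hA Hw.
  have sB := @dg_adjoin_sub _ hA z w.
  have [AB|nAB] := pselect (A = dg_adjoin (G `|` A) z w).
    by right; rewrite AB; apply: dg_adjoin_mem.
  case: (Amax (dg_adjoin (G `|` A) z w)).
    split=> [e Ae|BA]; first by apply: sB; right.
    by apply/nAB/seteqP; split => // e Ae; apply: sB; right.
  by rewrite setUidr // => e Ge; apply: sB; left.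
have [D DP] := choice tot.
have Dval e : (G `|` A) e -> D e.1 = e.2.
  by case: e => a b /(dg_inj hA (DP a)).
exists D; split; last by move=> e Ge; apply: Dval; left.
split=> a b; first exact: Dval (dg_add hA (DP a) (DP b)).
exact: Dval (dg_mul hA (DP a) (DP b)).
Qed.

End DerivationExtension.

(** Since [x] is transcendental over the image of [delta], no polynomial relation constrains the
    value at [x]. *)
Lemma derivation_extend (E E' : fieldType) (delta : {rmorphism E -> E'}) (x : E')
    (d : E -> E) (w : E') :
  char0 E' -> (forall p, p != 0 -> (map_poly delta p).[x] != 0) ->
  derivation d ->
  exists D, [/\ derivation D, forall c, D (delta c) = delta (d c) & D x = w].
Proof.
move=> cE' trx hd.
have dB a b : d (a - b) = d a - d b.
  by apply/eqP; rewrite eq_sym subr_eq -(derD hd) subrK.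
pose G := [set e : E' * E' | exists c, e = (delta c, delta (d c))]%classic.
have hG : der_graph G.
  split.
  - by exists 1; rewrite (der1 hd) rmorph1 rmorph0.
  - by move=> _ _ [a ->] [b ->]; exists (a - b); rewrite dB !rmorphB.
  - by move=> _ _ [a ->] [b ->]; exists (a * b); rewrite (derM hd) rmorphD !rmorphM.
  - move=> b [c [/esym/eqP]]; rewrite fmorph_eq0 => /eqP -> ->.
    by rewrite (der0 hd) rmorph0.
have H P Q : dg_poly G P Q -> root P x -> dual_eval x w P Q = 0.
  move=> h Px.
  have [p Pp] : exists p, P = map_poly delta p.
    have ex i : exists c, P`_i = delta c by case: (h i) => c [-> _]; exists c.
    have [f fP] := choice ex.
    exists (\poly_(i < size P) f i); apply/polyP => i.
    rewrite coef_map coef_poly; case: ltnP => [_|/(nth_default 0) ->] /=.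
      exact: fP.
    by rewrite rmorph0.
  have p0 : p = 0.
    by apply/eqP/negPn/negP => /trx; rewrite -Pp (eqP Px) eqxx.
  have P0 : P = 0 by rewrite Pp p0 rmorph0.
  suff -> : Q = 0 by rewrite /dual_eval P0 deriv0 !hornerE.
  apply/polyP => i; rewrite coef0; apply: (dg_fun hG).
  by have := h i; rewrite P0 coef0.
have [D [hD DG]] := der_graph_extend cE' (dg_adjoin_graph hG H).
exists D; split=> // [c|].
  by apply: (DG (delta c, delta (d c))); apply: dg_adjoin_sub => //; exists c.
exact: (DG _ (dg_adjoin_mem hG x w)).
Qed.

(** * Compositions of derivations and the Leibniz rule *)

Section IteratedDerivations.
Variable K : fieldType.
Implicit Types (s : seq (K -> K)) (a b : K) (D : K -> K).

Definition der_comp s a : K := foldr (fun D b => D b) a s.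
Definition derivations s := forall D, List.In D s -> derivation D.

Lemma der_compD s a b :
  derivations s -> der_comp s (a + b) = der_comp s a + der_comp s b.
Proof.
elim: s => //= D s IH H; rewrite IH => [|D' sD']; last by apply: H; right.
by rewrite derD //; apply: H; left.
Qed.

Lemma der_comp0 s : derivations s -> der_comp s 0 = 0.
Proof.
by move=> H; apply: (addrI (der_comp s 0)); rewrite -der_compD // !addr0.
Qed.

Lemma der_comp_sum s I (r : seq I) (P : pred I) f : derivations s ->
  der_comp s (\sum_(i <- r | P i) f i) = \sum_(i <- r | P i) der_comp s (f i).
Proof.
by move=> H; apply: big_morph => [a b|]; rewrite ?der_compD ?der_comp0.
Qed.

Lemma der_compMc s a c : derivations s ->
  (forall D, List.In D s -> D c = 0) -> der_comp s (a * c) = der_comp s a * c.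
Proof.
elim: s => //= D s IH H Hc; rewrite IH => [||D' sD']; last 2 first.
- by move=> D' sD'; apply: H; right.
- by apply: Hc; right.
by rewrite derMc //; [apply: H | apply: Hc]; left.
Qed.

Fixpoint assignments k n : seq (seq 'I_k) :=
  if n is n'.+1 then [seq c :: A | A <- assignments k n', c <- enum 'I_k]
  else [:: [::]].

Lemma size_assignments k n : size (assignments k n) = (k ^ n)%N.
Proof.
by elim: n => //= n IH; rewrite size_allpairs IH size_enum_ord expnSr.
Qed.

Lemma assignments_size k n A : A \in assignments k n -> size A = n.
Proof.
elim: n A => [|n IH] A; first by rewrite inE => /eqP ->.
by case/allpairsP => -[A' c] /= [/IH <- _ ->].
Qed.

(* Leibniz rule: [A] records which factor each derivation is applied to. *)
Lemma der_comp_prod s k (f : 'I_k -> K) : derivations s ->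
  der_comp s (\prod_c f c) =
  \sum_(A <- assignments k (size s))
     \prod_c der_comp (mask [seq c' == c | c' <- A] s) (f c).
Proof.
elim: s => [|D s IH] H.
  by rewrite big_seq1; apply: eq_bigr.
have hD : derivation D by apply: H; left.
rewrite /= IH => [|D' sD']; last by apply: H; right.
rewrite der_sum // big_allpairs_dep; apply: eq_bigr => A _.
rewrite der_prod // big_enum /=; apply: eq_bigr => c _.
by apply: eq_bigr => c' _; case: eqP.
Qed.

(** Each [D i] turns [z i] into a constant and kills every other factor, so the only surviving
    Leibniz term lets each derivation act on its own factor. *)
Lemma der_comp_multilinear d (D : 'I_d -> K -> K) (z e : 'I_d -> K) :
  (forall j, derivation (D j)) -> (forall i j, D i (e j) = 0) ->
  (forall i j, D i (z j) = if i == j then e i else 0) ->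
  der_comp [seq D j | j <- enum 'I_d] (\prod_j z j) = \prod_j e j.
Proof.
move=> hD De Dz; suff H t : uniq t ->
    der_comp [seq D j | j <- t] (\prod_j z j) =
    \prod_j (if j \in t then e j else z j).
  rewrite H ?enum_uniq //; apply: eq_bigr => j _; by rewrite mem_enum.
elim: t => [_|i t IH /= /andP[it ut]]; first by apply: eq_bigr.
rewrite IH // (bigD1 i) //= (negPf it) derM // Dz eqxx.
rewrite [X in _ + _ * X]der_prod_const //; last first.
  by move=> j ne; case: ifP => // _; rewrite Dz eq_sym (negPf ne).
rewrite mulr0 addr0 [RHS](bigD1 i) //= mem_head; congr (_ * _).
by apply: eq_bigr => j ne; rewrite inE (negPf ne).
Qed.

End IteratedDerivations.

(** * Forms and Waring decompositions *)

(** Multinomial coefficients are products of binomial ones; this makes the integer division in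
    [linpow] exact. *)
Lemma prod_fact_dvd m (a : 'I_m -> nat) :
  (\prod_(u < m) (a u)`! %| (\sum_(u < m) a u)`!)%N.
Proof.
elim: m a => [|m IH] a; first by rewrite !big_ord0.
rewrite !big_ord_recr /=; set A := (\sum_(_ < _) _)%N.
rewrite -(@bin_fact (A + a ord_max) A) ?leq_addr // addKn.
by apply: dvdn_mull; apply: dvdn_mul.
Qed.

Section Multinomial.
Variables (K : fieldType) (charK0 : char0 K).

Lemma char0_fact_neq0 s : s`!%:R != 0 :> K.
Proof. by case: s`! (fact_gt0 s). Qed.

(* The coefficients of a product of truncated exponentials [exp (z_u X)] are
   those of [exp ((\sum_u z_u) X)]. *)
Lemma multinomial_theorem m k (z : 'I_m -> K) :
  \sum_(a : {ffun 'I_m -> 'I_k.+1} | (\sum_(u < m) (a u : nat) == k)%N)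
     k`!%:R / (\prod_(u < m) (a u : nat)`!)%:R * \prod_(u < m) z u ^+ a u =
  (\sum_(u < m) z u) ^+ k.
Proof.
pose E (c : K) : {poly K} := \sum_(j < k.+1) (c ^+ j / j`!%:R) *: 'X^j.
have coefE c j : (j <= k)%N -> (E c)`_j = c ^+ j / j`!%:R.
  move=> lejk; rewrite /E coef_sum (bigD1 (Ordinal (lejk : (j < k.+1)%N))) //=.
  rewrite coefZ coefXn eqxx mulr1 big1 ?addr0 // => i ne.
  rewrite coefZ coefXn (_ : (j == i)%N = false) ?mulr0 //.
  by apply: contraNF ne => /eqP e; apply/eqP/val_inj.
have coefP j : (j <= k)%N ->
    (\prod_(u < m) E (z u))`_j = (\sum_(u < m) z u) ^+ j / j`!%:R.
  elim/big_rec2: _ j => [|u s p _ IH] j lejk.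
    by rewrite coef1 expr0n; case: j lejk => [|j] _; rewrite ?fact0 ?divr1 ?mul0r.
  rewrite coefM [z u + s]addrC exprDn mulr_suml; apply: eq_bigr => -[i /= lti] _.
  rewrite coefE ?IH; try lia.
  have leij : (i <= j)%N by lia.
  have /(congr1 (fun s : nat => s%:R : K)) := bin_fact leij.
  rewrite !natrM -mulr_natr => e.
  have := (char0_fact_neq0 i, char0_fact_neq0 (j - i), char0_fact_neq0 j).
  rewrite -[in RHS]mulr_natr; move: (j`!%:R) e => J <- [[i0 ji0] J0]; field.
  by rewrite i0 ji0 /=; move: J0; rewrite mulf_eq0 negb_or mul1r => /andP[].
rewrite -[RHS](divfK (char0_fact_neq0 k)) -coefP // /E bigA_distr_bigA /=.
rewrite coef_sum mulr_suml big_mkcond; apply: eq_bigr => a _ /=.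
rewrite scaler_prod prodrXr coefZ coefXn eq_sym; case: eqP => _; last first.
  by rewrite mulr0 mul0r.
rewrite mulr1 prodf_div natr_prod [in RHS]mulrC mulrA.
by rewrite [RHS]mulrAC.
Qed.

End Multinomial.

(** Uniqueness of digits in base [B]: the lowest one is read off modulo [B]. *)
Lemma kronecker_inj m B (a b : 'I_m -> 'I_B) :
  (\sum_(u < m) a u * B ^ u = \sum_(u < m) b u * B ^ u)%N -> a =1 b.
Proof.
elim: m a b => [|n IH] a b; first by move=> _ [].
have S c : (\sum_(u < n.+1) (c u : 'I_B) * B ^ u =
    c ord0 + B * \sum_(u < n) c (lift ord0 u) * B ^ u)%N.
  rewrite big_ord_recl expn0 muln1 big_distrr; congr (_ + _)%N.
  by apply: eq_bigr => u _; rewrite lift0 expnS mulnCA.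
rewrite !S => e.
have B0 : (0 < B)%N by apply: leq_ltn_trans (ltn_ord (a ord0)).
have e0 : a ord0 = b ord0.
  apply: val_inj; move/(congr1 (modn^~ B)): e => /=.
  by rewrite !(addnC (nat_of_ord _)) !(mulnC B) !modnMDl /= ?modn_small.
have /IH E : (\sum_(u < n) a (lift ord0 u) * B ^ u =
              \sum_(u < n) b (lift ord0 u) * B ^ u)%N.
  by move: e; rewrite e0 => /addnI /eqP; rewrite eqn_pmul2l // => /eqP.
by move=> u; case: (unliftP ord0 u) => [v ->|-> //]; apply: E.
Qed.

Section Evaluation.
Variables (K : fieldType) (charK0 : char0 K) (m k : nat).

Definition pol_eval (f : Pol K m k) (y : 'I_m -> nat) : K :=
  \sum_a (f a : K) * \prod_(u < m) (y u)%:R ^+ (val a u : nat).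

Lemma pol_eval_linpow (l : 'I_m -> K) y :
  pol_eval (linpow k l) y = (\sum_(u < m) l u * (y u)%:R) ^+ k.
Proof.
rewrite -multinomial_theorem // /pol_eval.
rewrite [RHS](reindex_omap (val : mono m k -> _) insub) => [|a Qa];
  last by rewrite insubT.
apply: eq_big => [a|a _]; first by rewrite (valP a) valK eqxx.
have -> : (linpow k l a : K) = (k`! %/ \prod_(u < m) (val a u : nat)`!)%:R *
    \prod_(u < m) l u ^+ (val a u : nat) by rewrite ffunE.
rewrite -mulrA -big_split /=.
congr (_ * _); last by apply: eq_bigr => u _; rewrite exprMn.
have := prod_fact_dvd (fun u => val a u : nat); rewrite (eqP (valP a)) => /dvdnP[q e].
have P0 : (0 < \prod_(u < m) (val a u : nat)`!)%N.
  by apply: prodn_gt0 => u; apply: fact_gt0.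
rewrite e mulnK // natrM mulfK //.
by case: (\prod_(_ < m) _)%N P0.
Qed.

(* Kronecker substitution: at [y u = s ^ (k.+1 ^ u)] distinct monomials become
   distinct powers of [s]. *)
Lemma pol_eval_inj (f g : Pol K m k) :
  (forall y, pol_eval f y = pol_eval g y) -> f = g.
Proof.
move=> H; pose N (a : mono m k) := (\sum_(u < m) val a u * k.+1 ^ u)%N.
have Ninj : injective N.
  by move=> a b /kronecker_inj e; apply/val_inj/ffunP.
pose p : {poly K} := \sum_a (f a - g a) *: 'X^(N a).
have p0 : p = 0.
  apply: char0_poly_eq0 => // s; exists s => //; rewrite rootE /p horner_sum.
  have := H (fun u => s ^ (k.+1 ^ u))%N; move/eqP; rewrite -subr_eq0.
  rewrite -sumrB; congr (_ == _); apply: eq_bigr => a _.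
  rewrite hornerZ hornerXn -mulrBl; congr (_ * _).
  rewrite /N -prodrXr; apply: eq_bigr => u _.
  by rewrite -natrX -natrX -expnM mulnC.
apply/ffunP => a; apply/eqP; rewrite -subr_eq0; apply/eqP.
have := congr1 (fun q : {poly K} => q`_(N a)) p0.
rewrite coef0 coef_sum (bigD1 a) //= coefZ coefXn eqxx mulr1 big1 ?addr0 // => b ne.
by rewrite coefZ coefXn (inj_eq Ninj) eq_sym (negPf ne) mulr0.
Qed.

End Evaluation.

(** * Polarization: a product as a signed sum of powers *)

Section Polarization.
Variables (R : comNzRingType) (k : nat).

(** The factor of index [ord0] keeps the sign +1, so only [2 ^ k] sign patterns are needed for
    [k.+1] factors. *)
Let sg (e : {ffun 'I_k -> bool}) (c : 'I_k.+1) : R :=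
  if unlift ord0 c is Some c' then (-1) ^+ e c' else 1.

Let cnt (g : {ffun 'I_k.+1 -> 'I_k.+1}) c := #|[pred i | g i == c]|.

Lemma odd_sum n (f : 'I_n -> nat) :
  (forall c, odd (f c)) -> odd (\sum_c f c) = odd n.
Proof.
elim: n f => [|n IH] f H; first by rewrite big_ord0.
by rewrite big_ord_recr /= oddD IH ?H //= addbT.
Qed.

(** The fibre sizes add up to [k.+1], so the remaining fibre is odd as well. No fibre is empty,
    hence [g] is surjective and therefore injective. *)
Lemma inj_of_odd_fibers (g : {ffun 'I_k.+1 -> 'I_k.+1}) :
  (forall c : 'I_k, odd (cnt g (lift ord0 c))) -> injectiveb g.
Proof.
move=> H; have tot : (\sum_c cnt g c = k.+1)%N.
  rewrite -[RHS](card_ord k.+1) -[RHS]sum1_card [RHS](partition_big g predT) //=.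
  by apply: eq_bigr => c _; rewrite /cnt -sum1_card.
have odd0 : odd (cnt g ord0).
  move/(congr1 odd): tot; rewrite big_ord_recl oddD odd_sum //=.
  by case: (odd k); case: odd.
have surj c : c \in codom g.
  have : odd (cnt g c) by case: (unliftP ord0 c) => [c' ->|->].
  case: (pickP [pred i | g i == c]) => [i /eqP <- _|none].
    exact: codom_f.
  by rewrite /cnt eq_card0.
apply/injectiveP => i j.
suff /image_injP : #|fintype.image g 'I_k.+1| == #|'I_k.+1| by apply.
rewrite eqn_leq leq_image_card subset_leq_card //.
by apply/fintype.subsetP => c _; apply: surj.
Qed.

(** The sum factors over [c] into terms [1 + (-1) ^+ (cnt g (lift ord0 c)).+1], which are 2 for an
    odd fibre and 0 for an even one. *)
Lemma sum_sign (g : {ffun 'I_k.+1 -> 'I_k.+1}) :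
  \sum_(e : {ffun 'I_k -> bool}) (\prod_c (-1) ^+ e c) * \prod_i sg e (g i) =
  (if injectiveb g then (2 ^ k)%:R else 0 : R).
Proof.
have fib e : \prod_i sg e (g i) = \prod_c ((-1) ^+ e c) ^+ cnt g (lift ord0 c).
  rewrite (partition_big g predT) //= big_ord_recl.
  rewrite big1 ?mul1r => [|i /eqP ->]; last by rewrite /sg unlift_none.
  apply: eq_bigr => c _; rewrite -prodr_const; apply: eq_bigr => i /eqP ->.
  by rewrite /sg liftK.
under eq_bigr => e _ do rewrite fib -big_split /=.
rewrite -(bigA_distr_bigA (fun (c : 'I_k) (b : bool) =>
  ((-1) ^+ b * ((-1) ^+ b) ^+ cnt g (lift ord0 c)) : R)) /=.
under eq_bigr => c _ do rewrite big_bool /= expr1n mul1r expr1 -exprS.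
case: ifPn => [/injectiveP ginj|nginj].
  rewrite (eq_bigr (fun=> 2%:R)) => [|c _]; last first.
    rewrite (_ : cnt g (lift ord0 c) = 1)%N ?sqrrN ?expr1n //.
    have [h gK hK] := injF_bij ginj.
    rewrite /cnt -(card1 (h (lift ord0 c))); apply: eq_card => i.
    by rewrite !inE -(can2_eq gK hK) ?(can_eq gK).
  by rewrite prodr_const card_ord natrX.
have : ~~ [forall c : 'I_k, odd (cnt g (lift ord0 c))].
  by apply: contra nginj => /forallP; apply: inj_of_odd_fibers.
rewrite negb_forall => /existsP[c ev]; rewrite (bigD1 c) //=.
by rewrite -signr_odd /= ev expr1 addNr mul0r.
Qed.

(** Expanding the power gives a sum over maps [g], of which [sum_sign] keeps the [(k.+1)!]
    permutations, all with the same product. *)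
Lemma polarization (y : 'I_k.+1 -> R) :
  \sum_(e : {ffun 'I_k -> bool}) (\prod_c (-1) ^+ e c) *
     (y ord0 + \sum_(c < k) (-1) ^+ e c * y (lift ord0 c)) ^+ k.+1 =
  (2 ^ k * (k.+1)`!)%:R * \prod_c y c.
Proof.
have expand (e : {ffun 'I_k -> bool}) :
    (y ord0 + \sum_(c < k) (-1) ^+ e c * y (lift ord0 c)) ^+ k.+1 =
    \sum_(g : {ffun 'I_k.+1 -> 'I_k.+1}) \prod_i sg e (g i) * \prod_i y (g i).
  transitivity (\prod_(i < k.+1) \sum_c sg e c * y c).
    rewrite prodr_const card_ord big_ord_recl {1}/sg unlift_none mul1r.
    by congr ((_ + _) ^+ _); apply: eq_bigr => c _; rewrite /sg liftK.
  by rewrite bigA_distr_bigA /=; apply: eq_bigr => g _; rewrite big_split.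
transitivity (\sum_(g : {ffun 'I_k.+1 -> 'I_k.+1})
    (if injectiveb g then (2 ^ k)%:R else 0) * \prod_i y (g i)).
  rewrite (eq_bigr _ (fun e _ => congr1 _ (expand e))).
  under eq_bigr => e _ do rewrite mulr_sumr.
  rewrite exchange_big; apply: eq_bigr => g _ /=.
  by rewrite -sum_sign mulr_suml; apply: eq_bigr => e _; rewrite mulrA.
rewrite (bigID (fun g : {ffun 'I_k.+1 -> 'I_k.+1} => injectiveb g)) /=.
rewrite [X in _ + X]big1 ?addr0 => [|g /negPf ->]; last first.
  by rewrite mul0r.
rewrite (eq_bigr (fun=> (2 ^ k)%:R * \prod_c y c)) => [|g gi]; last first.
  by rewrite gi; congr (_ * _); rewrite [RHS](reindex_inj (injectiveP _ gi)).
rewrite sumr_const -[LHS]mulr_natr natrM mulrAC; congr (_ * _%:R * _).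
have := card_inj_ffuns 'I_k.+1 'I_k.+1; rewrite !card_ord ffactnn => <-.
by apply: eq_card => g; rewrite !inE.
Qed.

End Polarization.

(* A form is handled through its values at the points with natural coordinates;
   these are constants for every derivation. *)
Definition waring (K : fieldType) (m k : nat) (g : ('I_m -> nat) -> K) (R : nat) :=
  exists l : 'I_R -> 'I_m -> K,
    forall y, g y = \sum_(i < R) (\sum_u l i u * (y u)%:R) ^+ k.

Section Waring.
Variables (K : fieldType) (m : nat).
Implicit Types (g h : ('I_m -> nat) -> K) (L : 'I_m -> K).

Lemma waring_ext k g h R : (forall y, g y = h y) -> waring k g R -> waring k h R.
Proof. by move=> e [l H]; exists l => y; rewrite -e. Qed.

Lemma waring_power k L : waring k (fun y => (\sum_u L u * (y u)%:R) ^+ k) 1.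
Proof. by exists (fun=> L) => y; rewrite big_ord1. Qed.

Lemma waring_add k g h R R' : waring k g R -> waring k h R' ->
  waring k (fun y => g y + h y) (R + R').
Proof.
move=> [l H] [l' H'].
exists (fun i => match fintype.split i with inl j => l j | inr j => l' j end).
move=> y; rewrite H H' big_split_ord /=; congr (_ + _); apply: eq_bigr => i _.
  by rewrite (unsplitK (inl i)).
by rewrite (unsplitK (inr i)).
Qed.

Lemma waring_zero k R : (0 < k)%N -> waring k (fun y : 'I_m -> nat => 0 : K) R.
Proof.
move=> k0; exists (fun _ _ => 0) => y; rewrite big1 // => i _.
by rewrite big1 ?expr0n ?gtn_eqF // => u _; rewrite mul0r.
Qed.

Lemma waring_mono k g R R' : (0 < k)%N -> (R <= R')%N -> waring k g R -> waring k g R'.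
Proof.
move=> k0 le H; rewrite -(subnKC le).
by apply: (waring_ext _ (waring_add H (waring_zero (R' - R) k0))) => y; rewrite addr0.
Qed.

Lemma waring_sum k (I : eqType) (s : seq I) (g : I -> ('I_m -> nat) -> K) R :
  (0 < k)%N -> {in s, forall i, waring k (g i) R} ->
  waring k (fun y => \sum_(i <- s) g i y) (size s * R).
Proof.
move=> k0; elim: s => [|i s IH] H.
  by apply: (waring_ext _ (waring_zero 0 k0)) => y; rewrite big_nil.
have {}IH := IH (fun j js => H j (mem_behead (s := i :: s) js)).
apply: (waring_ext _ (waring_add (H i (mem_head _ _)) IH)) => y.
by rewrite big_cons.
Qed.

Lemma waring_prod k (L : 'I_k.+1 -> 'I_m -> K) : char0 K ->
  (forall s : nat, exists t : K, t ^+ k.+1 = s%:R^-1) ->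
  (exists t : K, t ^+ k.+1 = -1) ->
  waring k.+1 (fun y => \prod_c \sum_u L c u * (y u)%:R) (2 ^ k).
Proof.
move=> cK rootN [t tE]; have [q qE] := rootN (2 ^ k * (k.+1)`!)%N.
pose S := enum {ffun 'I_k -> bool}.
have szS : (2 ^ k = size S * 1)%N.
  by rewrite muln1 /S -cardT card_ffun card_bool card_ord.
(* The roots [q] and [t] move the polarization denominator and the signs inside the powers. *)
rewrite szS; pose sc (e : {ffun 'I_k -> bool}) := q * \prod_c t ^+ e c.
pose L' (e : {ffun 'I_k -> bool}) u :=
  sc e * (L ord0 u + \sum_(c < k) (-1) ^+ e c * L (lift ord0 c) u).
apply: (waring_ext _ (waring_sum (g := fun e y => (\sum_u L' e u * (y u)%:R) ^+ k.+1)
  _ (fun e _ => waring_power _ _))) => // y.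
have N0 : (2 ^ k * (k.+1)`!)%:R != 0 :> K.
  by case: (2 ^ k * (k.+1)`!)%N (muln_gt0 (2 ^ k) (k.+1)`!); rewrite ?expn_gt0 ?fact_gt0.
rewrite -[RHS](mulKf N0) big_enum -polarization mulr_sumr; apply: eq_bigr => e _.
have -> : \sum_u L' e u * (y u)%:R = sc e * (\sum_u L ord0 u * (y u)%:R +
   \sum_(c < k) (-1) ^+ e c * \sum_u L (lift ord0 c) u * (y u)%:R).
  under [X in _ * (_ + X)]eq_bigr => c _ do rewrite mulr_sumr.
  rewrite exchange_big -big_split /= mulr_sumr; apply: eq_bigr => u _.
  rewrite /L' -mulrA mulrDl mulr_suml; congr (_ * (_ + _)).
  by apply: eq_bigr => c _; rewrite mulrA.
rewrite exprMn mulrA; congr (_ * _).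
rewrite /sc exprMn qE -prodrXl; congr (_ * _); apply: eq_bigr => c _.
by rewrite exprAC tE.
Qed.

Lemma waring_pol_eval k (f : Pol K m k) R : char0 K ->
  wrk_le f R <-> waring k (pol_eval f) R.
Proof.
move=> cK; have E (l : 'I_R -> 'I_m -> K) y :
    pol_eval (\sum_i linpow k (l i)) y = \sum_i (\sum_u l i u * (y u)%:R) ^+ k.
  under [RHS]eq_bigr => i _ do rewrite -(pol_eval_linpow cK).
  rewrite /pol_eval exchange_big; apply: eq_bigr => a _ /=.
  by rewrite -mulr_suml; congr (_ * _); rewrite sum_ffunE.
split=> [[l ->]|[l H]]; exists l => //.
by apply: (pol_eval_inj cK) => y; rewrite H E.
Qed.

End Waring.

(** * The generic point *)

Section PointwiseOperations.
Variables (S : Type) (K : comNzRingType).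
Implicit Types f g : S -> K.

Lemma fct_mulE f g s : (f * g) s = f s * g s. Proof. by []. Qed.

Lemma fct_prodE I (r : seq I) (P : pred I) (f : I -> S -> K) s :
  (\prod_(i <- r | P i) f i) s = \prod_(i <- r | P i) f i s.
Proof. by elim/big_rec2: _ => //= i y f' _ <-. Qed.

Lemma fct_expE f e s : (f ^+ e) s = f s ^+ e.
Proof. by elim: e => // e IH; rewrite !exprS -IH. Qed.

Lemma fct_natE e s : (e%:R : S -> K) s = e%:R.
Proof. by elim: e => // e IH; rewrite !mulrS -IH. Qed.

End PointwiseOperations.

Section GenericPoint.
Variables (F : fieldType) (n m d k r : nat) (c : {ffun 'I_d -> 'I_n} -> Pol F m k).
Hypothesis charF0 : char0 F.

Definition pol_map (K K' : fieldType) (f : K -> K') (p : Pol K m k) : Pol K' m k :=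
  [ffun a => f (p a)].

(** With [c I] the image of the basis tensor of index [I], this is the image of the rank-one tensor
    with factors [v j], after extension of scalars along [iota]. *)
Definition multilinear_map (K : fieldType) (iota : F -> K) (v : 'I_d -> 'I_n -> K) :
    Pol K m k :=
  [ffun a => \sum_(I : {ffun 'I_d -> 'I_n}) (\prod_j v j (I j)) * iota (c I a)].

Lemma rmorph_linpow_sum (K K' : fieldType) (pi : {rmorphism (nat -> K) -> K'}) R
    (l : 'I_R -> 'I_m -> nat -> K) a :
  pi (fun s => (\sum_i linpow k (fun u => l i u s)) a) =
  (\sum_i linpow k (fun u => pi (l i u))) a :> K'.
Proof.
have linpowE (E : fieldType) (L : 'I_R -> 'I_m -> E) :
    ((\sum_i linpow k (L i)) a : E) =
    \sum_i (k`! %/ \prod_u (val a u : nat)`!)%:R * \prod_u L i u ^+ (val a u : nat).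
  by rewrite sum_ffunE; apply: eq_bigr => i _; rewrite ffunE.
rewrite linpowE.
have -> : (fun s => (\sum_i linpow k (fun u => l i u s)) a : K) =
    \sum_i (k`! %/ \prod_u (val a u : nat)`!)%:R * \prod_u l i u ^+ (val a u : nat).
  apply/funext => s; rewrite linpowE fct_sumE; apply: eq_bigr => i _.
  rewrite [RHS]fct_mulE fct_natE fct_prodE; congr (_ * _).
  by apply: eq_bigr => u _; rewrite fct_expE.
rewrite rmorph_sum; apply: eq_bigr => i _.
rewrite rmorphM rmorph_nat rmorph_prod; congr (_ * _).
by apply: eq_bigr => u _; rewrite rmorphXn.
Qed.

Lemma generic_point N : (forall v, wrk_le (multilinear_map (@id F) v) r) ->
  exists (K : fieldType) (iota : {rmorphism F -> K}) (x : nat -> K) (D : nat -> K -> K),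
  [/\ forall a, derivation (D a),
      forall a z, D a (iota z) = 0,
      forall a b, (a < N)%N -> (b < N)%N -> D a (x b) = (a == b)%:R,
      forall v, wrk_le (multilinear_map iota v) r &
      forall f R, wrk_le (pol_map iota f) R -> wrk_le f R].
Proof.
move=> H; elim: N => [|N [K [iota [x [D [hD Di Dx up down]]]]]].
  exists F, (@idfun F : {rmorphism F -> F}), (fun=> 0), (fun _ _ => 0); split=> //.
    by split=> *; rewrite ?addr0 ?mul0r ?mulr0 ?addr0.
  by move=> f R; rewrite (_ : pol_map _ f = f) //; apply/ffunP => a; rewrite ffunE.
have charK0 : char0 K.
  by move=> s; rewrite -(rmorph_nat iota) fmorph_eq0; apply: charF0.
have [K' [pi [x' [pi_surj pi_fin x'_tr]]]] := generic_extension charK0.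
pose delta : {rmorphism K -> K'} := pi \o @const_seq K.
have charK'0 : char0 K'.
  by move=> s; rewrite -(rmorph_nat delta) fmorph_eq0; apply: charK0.
(* Old derivations are prolonged by zero at [x']. The new one, of index [N], prolongs the zero
   derivation and takes the value 1 at [x']. *)
pose D0 a : K -> K := if (a < N)%N then D a else fun=> 0.
have hD0 a : derivation (D0 a).
  rewrite /D0; case: ifP => // _.
  by split=> *; rewrite ?addr0 ?mul0r ?mulr0 ?addr0.
have exD a : exists D', [/\ derivation D', forall z, D' (delta z) = delta (D0 a z)
    & D' x' = (a == N)%:R].
  exact: derivation_extend.
have [D' D'P] := choice exD.
exists K', (delta \o iota : {rmorphism F -> K'}).
exists (fun b => if (b < N)%N then delta (x b) else x'), D'; split.
- by move=> a; case: (D'P a).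
- move=> a z; case: (D'P a) => _ /= -> _; rewrite /D0; case: ifP => _.
    by rewrite Di rmorph0.
  by rewrite rmorph0.
- move=> a b; rewrite !ltnS => aN bN; case: (D'P a) => _ Dd Dx'.
  case: ifP => bltN; last first.
    by rewrite Dx' (_ : b = N) //; apply/eqP; rewrite eqn_leq bN leqNgt bltN.
  rewrite Dd /D0; case: ifP => altN; first by rewrite Dx // rmorph_nat.
  by rewrite rmorph0; case: eqP => // e; rewrite e bltN in altN.
- move=> v.
  (* [v] is lifted to sequences, decomposed at each index [s], and the classes of the resulting
     forms decompose the image over [K']. *)
  have ex_vs (p : 'I_d * 'I_n) : exists f, pi f = v p.1 p.2 by apply: pi_surj.
  have [vs vsP] := choice ex_vs.
  have [l lP] := choice (fun s => up (fun j i => vs (j, i) s)).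
  exists (fun i u => pi (fun s => l s i u)); apply/ffunP => a.
  rewrite -rmorph_linpow_sum.
  have -> : (fun s => (\sum_i linpow k (fun u => l s i u)) a : K) =
      \sum_(I : {ffun 'I_d -> 'I_n}) (\prod_j vs (j, I j)) * const_seq (iota (c I a)).
    apply/funext => s; rewrite -lP ffunE.
    rewrite fct_sumE; apply: eq_bigr => I _.
    by rewrite [RHS]fct_mulE fct_prodE.
  rewrite ffunE rmorph_sum; apply: eq_bigr => I _.
  rewrite rmorphM rmorph_prod; congr (_ * _).
  by apply: eq_bigr => j _; rewrite vsP.
move=> f R [l lP]; apply: down.
have ex_ls (p : 'I_R * 'I_m) : exists f, pi f = l p.1 p.2 by apply: pi_surj.
have [ls lsP] := choice ex_ls.
(* The coefficientwise errors form a finite family of null sequences, so at some index all of them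
   vanish. *)
pose g (a : mono m k) s : K :=
  iota (f a) - (\sum_i linpow k (fun u => ls (i, u) s)) a.
have [|s sP] := pi_fin _ g.
  move=> a; rewrite (_ : g a = const_seq (iota (f a)) -
    (fun s => (\sum_i linpow k (fun u => ls (i, u) s)) a : K)) // rmorphB.
  rewrite (rmorph_linpow_sum pi (fun i u => ls (i, u))).
  have := congr1 (fun p : Pol K' m k => p a : K') lP; rewrite ffunE => e.
  apply/eqP; rewrite subr_eq0; apply/eqP; rewrite [LHS]e.
  rewrite !sum_ffunE; apply: eq_bigr => i _; congr (linpow k _ a).
  by apply/funext => u; rewrite lsP.
exists (fun i u => ls (i, u) s); apply/ffunP => a; rewrite ffunE.
by apply/eqP; rewrite -subr_eq0; apply/eqP; apply: sP.
Qed.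

End GenericPoint.

(** * Largest fibres and the bound at the generic point *)

Lemma large_fiber d k (a : 'I_d -> 'I_k.+1) :
  exists c, (d <= k.+1 * #|[pred j | a j == c]|)%N.
Proof.
case: d a => [|d] a; first by exists ord0.
case: (boolP [exists c, d.+1 <= k.+1 * #|[pred j | a j == c]|]%N) => [/existsP //|].
rewrite negb_exists => /forallP H.
have tot : (\sum_c #|[pred j | a j == c]| = d.+1)%N.
  rewrite -[RHS](card_ord d.+1) -[RHS]sum1_card [RHS](partition_big a predT) //=.
  by apply: eq_bigr => c _; rewrite -sum1_card.
have : (\sum_c k.+1 * #|[pred j | a j == c]| <= \sum_(c < k.+1) d)%N.
  by apply: leq_sum => c _; rewrite -ltnS ltnNge H.
by rewrite -big_distrr /= tot sum_nat_const card_ord leq_pmul2l // ltnn.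
Qed.

Lemma card_off_fiber d k (a : 'I_d -> 'I_k.+1) c :
  (d <= k.+1 * #|[pred j | a j == c]|)%N ->
  (#|[pred j | a j != c]| <= k * d %/ k.+1)%N.
Proof.
move=> H; rewrite leq_divRL //.
have : (#|[pred j | a j == c]| + #|[pred j | a j != c]| = d)%N.
  by rewrite -[RHS](card_ord d) -(cardC [pred j | a j == c]).
nia.
Qed.

Section Core.
Variables (K : fieldType) (n m d k : nat).
Hypothesis charK0 : char0 K.
Hypothesis rootN : forall s : nat, exists t : K, t ^+ k.+1 = s%:R^-1.
Hypothesis rootN1 : exists t : K, t ^+ k.+1 = -1.
Hypothesis n_gt0 : (0 < n)%N.

Variables (x : 'I_d -> 'I_n -> K) (D : 'I_d -> 'I_n -> K -> K).
Hypothesis hD : forall j i, derivation (D j i).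
Hypothesis Dx : forall j i j' i', D j i (x j' i') = ((j == j') && (i == i'))%:R.

Definition partial (I : {ffun 'I_d -> 'I_n}) (t : seq 'I_d) : K -> K :=
  der_comp [seq D j (I j) | j <- t].

Lemma derivations_partial (I : {ffun 'I_d -> 'I_n}) t :
  derivations [seq D j (I j) | j <- t].
Proof.
by elim: t => [|j t IH] D' //= [<-|/IH //]; apply: hD.
Qed.

Lemma partial_linear_form I t (L : 'I_m -> K) (y : 'I_m -> nat) :
  partial I t (\sum_u L u * (y u)%:R) = \sum_u partial I t (L u) * (y u)%:R.
Proof.
have h := @derivations_partial I t.
rewrite /partial der_comp_sum //; apply: eq_bigr => u _.
rewrite der_compMc // => D' tD'; apply: der_nat; exact: h.
Qed.

Lemma eq_partial (I J : {ffun 'I_d -> 'I_n}) (t : seq 'I_d) :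
  {in t, I =1 J} -> partial I t =1 partial J t.
Proof.
move=> e z; rewrite /partial; congr (der_comp _ z).
by apply/eq_in_map => j /e ->.
Qed.

Lemma mask_fiber (a : seq 'I_k.+1) c (j : 'I_d) :
  size a = d -> j \in mask [seq c' == c | c' <- a] (enum 'I_d) -> nth ord0 a j = c.
Proof.
move=> sa; rewrite in_mask ?enum_uniq // index_enum_ord mem_enum /=.
by rewrite (nth_map ord0) ?sa // => /eqP.
Qed.

(* The largest fibre of the assignment [a] supplies a single linear form, which
   absorbs the sum over the indices of [v] that belong to this fibre. *)
Lemma waring_assignment (v : {ffun 'I_d -> 'I_n} -> K) (L : 'I_m -> K) (a : seq 'I_k.+1) :
    size a = d ->
  waring k.+1 (fun y => \sum_(I : {ffun 'I_d -> 'I_n}) v I *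
     \prod_(c < k.+1) partial I (mask [seq c' == c | c' <- a] (enum 'I_d))
               (\sum_u L u * (y u)%:R))
    (n ^ (k * d %/ k.+1) * 2 ^ k).
Proof.
move=> sa; pose fa (j : 'I_d) := nth ord0 a j.
have [c0 /card_off_fiber cardT] := large_fiber fa.
pose T := [pred j | fa j != c0]; pose i0 : 'I_n := Ordinal n_gt0.
pose M (I : {ffun 'I_d -> 'I_n}) c :=
  partial I (mask [seq c' == c | c' <- a] (enum 'I_d)).
(* Restrictions of multi-indices to [T] are represented by the functions equal to the default [i0]
   off [T]; there are [n ^ #|T|] of them. *)
pose res (I : {ffun 'I_d -> 'I_n}) : {ffun 'I_d -> 'I_n} :=
  [ffun j => if T j then I j else i0].
pose Q : pred {ffun 'I_d -> 'I_n} := pffun_on i0 T predT.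
have resQ I : Q (res I).
  apply/pffun_onP; split=> //; apply/fintype.subsetP => j.
  by rewrite !inE ffunE /=; case: (fa j != c0) => //; rewrite eqxx.
(* Factors other than [c0] involve only positions in [T]. *)
have Mres I c : c != c0 -> M I c =1 M (res I) c.
  move=> ne; apply: eq_partial => j /(mask_fiber sa) e.
  by rewrite ffunE /= /fa e ne.
pose N (J : {ffun 'I_d -> 'I_n}) c u :=
  if c == c0 then \sum_(I | res I == J) v I * M I c0 (L u) else M J c (L u).
apply: (waring_mono (R := size (enum Q) * 2 ^ k)) => //.
  rewrite leq_mul2r; apply/orP; right.
  by rewrite -cardE card_pffun_on card_ord leq_pexp2l.
apply: (waring_ext _ (waring_sum (g := fun J y => \prod_c \sum_u N J c u * (y u)%:R)
  _ (fun J _ => waring_prod _ charK0 rootN rootN1))) => // y.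
rewrite big_enum [RHS](partition_big res Q) //=; apply: eq_bigr => J _.
rewrite (bigD1 c0) //= {1}/N eqxx.
under eq_bigr => u _ do rewrite mulr_suml.
rewrite exchange_big mulr_suml; apply: eq_bigr => I /eqP rI.
rewrite [in RHS](bigD1 c0) //= mulrA partial_linear_form mulr_sumr.
congr (_ * _).
  by apply: eq_bigr => u _; rewrite mulrA.
apply: eq_bigr => c ne; rewrite partial_linear_form; apply: eq_bigr => u _.
by rewrite /N (negPf ne) -rI -[in LHS]Mres.
Qed.

Lemma waring_generic r (C : {ffun 'I_d -> 'I_n} -> ('I_m -> nat) -> K)
    (l : 'I_r -> 'I_m -> K) (v : {ffun 'I_d -> 'I_n} -> K) :
    (forall j i I y, D j i (C I y) = 0) ->
    (forall y, \sum_(I : {ffun 'I_d -> 'I_n}) (\prod_j x j (I j)) * C I y =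
       \sum_i (\sum_u l i u * (y u)%:R) ^+ k.+1) ->
  waring k.+1 (fun y => \sum_(I : {ffun 'I_d -> 'I_n}) v I * C I y)
    (2 ^ k * k.+1 ^ d * n ^ (k * d %/ k.+1) * r).
Proof.
move=> DC H.
(* Applying [partial I] to the generic identity leaves only the term [J = I] on the left; Leibniz
   expands the right. *)
have CE I y : C I y = \sum_(i < r) \sum_(a <- assignments k.+1 d)
    \prod_(c < k.+1) partial I (mask [seq c' == c | c' <- a] (enum 'I_d))
      (\sum_u l i u * (y u)%:R).
  have h := @derivations_partial I (enum 'I_d).
  have := congr1 (partial I (enum 'I_d)) (H y); rewrite /partial !der_comp_sum //.
  under eq_bigr => J _.
    rewrite der_compMc //; last first.
      move=> D'; elim: (enum _) => //= j t IH [<-|/IH //]; exact: DC.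
    rewrite (@der_comp_multilinear _ _ (fun j => D j (I j)) (fun j => x j (J j))
      (fun j => (I j == J j)%:R)); [|by []|by move=> *; apply: der_nat|]; last first.
      by move=> i j; rewrite Dx; case: eqP => //= ->.
    over.
  rewrite (bigD1 I) //= big1 => [|j _]; last by rewrite eqxx.
  rewrite mul1r big1 => [|J ne]; last first.
    have [j nej] : exists j, I j != J j.
      apply/existsP; rewrite -negb_forall; apply: contra ne => /forallP e.
      by apply/eqP/ffunP => j; apply/esym/eqP.
    by rewrite (bigD1 j) //= (negPf nej) !mul0r.
  rewrite addr0 => ->; apply: eq_bigr => i _.
  rewrite -[X in _ ^+ X](card_ord k.+1) -prodr_const der_comp_prod //.
  rewrite size_map size_enum_ord; apply: eq_bigr => a _.
  by apply: eq_bigr => c _; rewrite /partial map_mask.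
(* One summand for each power and each assignment, [r * k.+1 ^ d] in all. *)
pose g (p : 'I_r * seq 'I_k.+1) y := \sum_(I : {ffun 'I_d -> 'I_n}) v I *
  \prod_(c < k.+1) partial I (mask [seq c' == c | c' <- p.2] (enum 'I_d))
    (\sum_u l p.1 u * (y u)%:R).
have := @waring_sum K m k.+1 _ [seq (i, a) | i <- enum 'I_r, a <- assignments k.+1 d]
  g (n ^ (k * d %/ k.+1) * 2 ^ k) isT.
rewrite size_allpairs size_enum_ord size_assignments.
rewrite (_ : (r * k.+1 ^ d * (n ^ (k * d %/ k.+1) * 2 ^ k) =
  2 ^ k * k.+1 ^ d * n ^ (k * d %/ k.+1) * r)%N); last by ring.
move=> W; apply: (waring_ext _ (W _)) => [y|].
  rewrite big_allpairs big_enum /=.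
  under [RHS]eq_bigr => I _ do rewrite CE mulr_sumr.
  rewrite [RHS]exchange_big; apply: eq_bigr => i _ /=.
  under [RHS]eq_bigr => I _ do rewrite mulr_sumr.
  by rewrite [RHS]exchange_big.
by move=> _ /allpairsP[[i a] /= [_ /assignments_size sa ->]]; apply: waring_assignment.
Qed.

End Core.

(** * The bound over an algebraically closed field *)

Theorem theorem1p11 (F : closedFieldType) (charF0 : [pchar F] =i pred0)
  (n m d k : nat) (hn : (0 < n)%N) (hm : (0 < m)%N) (hd : (0 < d)%N) (hk : (0 < k)%N)
  (phi : Ten F n d -> Pol F m k)
  (phi_lin : forall (a : F) (x y : Ten F n d), phi (a *: x + y) = a *: phi x + phi y)
  (phi_nz : exists t : Ten F n d, phi t != 0) :
  (* Pot(phi) <= B, i.e. mu(V) <= B * mu(S): every upper bound r on the Waring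
     ranks of the images of rank-one tensors gives the bound B*r on all of V *)
  forall r : nat,
    (forall s : Ten F n d, rank_one s -> wrk_le (phi s) r) ->
    forall v : Ten F n d,
      wrk_le (phi v) (2 ^ (k - 1) * k ^ d * n ^ ((k - 1) * d %/ k) * r)%N.
Proof.
move=> r hr v; case: k hk phi phi_lin {phi_nz} hr => // k' _ f f_lin hr; rewrite subn1 /=.
have cF : char0 F by move=> s; rewrite ((pcharf0P F).1 charF0).
pose basis (I : {ffun 'I_d -> 'I_n}) : Ten F n d := [ffun J => (J == I)%:R].
have fE (t : Ten F n d) : f t = \sum_(I : {ffun 'I_d -> 'I_n}) t I *: f (basis I).
  have f0 : f 0 = 0.
    by have := f_lin (-1) 0 0; rewrite scaler0 addr0 scaleN1r addNr.
  have {1}-> : t = \sum_(I : {ffun 'I_d -> 'I_n}) t I *: basis I.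
    apply/ffunP => J; rewrite sum_ffunE (bigD1 J) //= !ffunE eqxx.
    rewrite big1 => [|I ne]; first by rewrite addr0 [RHS]mulr1.
    by rewrite !ffunE eq_sym (negPf ne) [LHS]mulr0.
  elim/big_rec2: _ => // I p q _ <-; exact: f_lin.
have [|K [iota [x [D [hD Di Dx up down]]]]] :=
  @generic_point F n m d k'.+1 r (f \o basis) cF #|{: 'I_d * 'I_n}|.
  move=> w; have := hr [ffun I : {ffun 'I_d -> 'I_n} => \prod_j w j (I j)].
  rewrite fE => /(_ (ex_intro _ w erefl)); congr (wrk_le _ r).
  apply/ffunP => a; rewrite [RHS]ffunE sum_ffunE; apply: eq_bigr => I _.
  by rewrite !ffunE.
have cK : char0 K by move=> s; rewrite -(rmorph_nat iota) fmorph_eq0; apply: cF.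
(* [K] need not be algebraically closed, but roots are only required of elements of [F]. *)
have root (z : F) : exists t : K, t ^+ k'.+1 = iota z.
  have [t tE] := @GRing.solve_monicpoly F k'.+1 (fun i => if i == 0%N then z else 0) isT.
  exists (iota t); rewrite -rmorphXn tE big_ord_recl big1 ?addr0 ?mulr1 // => i _.
  by rewrite mul0r.
(* The pairs [(j, i)] number the coordinates of the generic point. *)
pose idx (j : 'I_d) (i : 'I_n) : nat := enum_rank (j, i).
have [l lE] := (waring_pol_eval _ _ cK).1 (up (fun j i => x (idx j i))).
apply: down; apply/waring_pol_eval => //.
have evE (t : {ffun 'I_d -> 'I_n} -> K) y :
    pol_eval [ffun a => \sum_(I : {ffun 'I_d -> 'I_n}) t I * iota (f (basis I) a)] y =
    \sum_(I : {ffun 'I_d -> 'I_n}) t I * pol_eval (pol_map iota (f (basis I))) y.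
  rewrite /pol_eval; under [RHS]eq_bigr => I _ do rewrite mulr_sumr.
  rewrite exchange_big; apply: eq_bigr => a _; rewrite ffunE mulr_suml.
  by apply: eq_bigr => I _; rewrite ffunE mulrA.
apply: (waring_ext _ (@waring_generic K n m d k' cK _ _ hn (fun j i => x (idx j i))
  (fun j i => D (idx j i)) _ _ r (fun I y => pol_eval (pol_map iota (f (basis I))) y)
  l (fun I => iota (v I)) _ _)) => [y|s||||j i I y|y] //.
- rewrite -evE; congr (pol_eval _ y); apply/ffunP => a; rewrite !ffunE fE.
  rewrite sum_ffunE rmorph_sum; apply: eq_bigr => I _.
  by rewrite ffunE rmorphM.
- by have [t tE] := root s%:R^-1; exists t; rewrite tE fmorphV rmorph_nat.
- by have [t tE] := root (-1); exists t; rewrite tE rmorphN1.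
- move=> j i j' i'; rewrite Dx ?ltn_ord // /idx.
  by rewrite (inj_eq val_inj) (inj_eq enum_rank_inj) xpair_eqE.
- rewrite /pol_eval der_sum //; apply: big1 => a _.
  rewrite derM // ffunE Di mul0r add0r der_prod_const ?mulr0 // => u _.
  by rewrite -natrX der_nat.
by rewrite -lE -evE.
Qed.
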